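(* For all nonnegative integers $n,k,\ell,m$, the number $B(n,k,\ell,m)$ of permutations $\sigma$ of $[n]$ with $k$ weak exceedances, $\ell$ crossings and $m$ nestings is equal to the number $D(n,k,\ell,m)$ of permutations of $[n]$ with $n-k$ descents, $\ell$ occurrences of the pattern $31\text{-}2$ and $m$ occurrences of the pattern $2\text{-}31$.
   Context: Let $\sigma$ be a permutation of $[n]=\{1,\dots,n\}$. The number of weak exceedances of $\sigma$ is $|\{j : \sigma(j)\ge j\}|$. For $i\in[n]$ let $C_+(i)=\{j : j<i\le \sigma(j)<\sigma(i)\}$, $C_-(i)=\{j : j>i>\sigma(j)>\sigma(i)\}$, $A_+(i)=\{j : j<i\le\sigma(i)<\sigma(j)\}$, $A_-(i)=\{j : j>i>\sigma(i)>\sigma(j)\}$, and set $C_\pm(\sigma)=\sum_{i=1}^n|C_\pm(i)|$, $A_\pm(\sigma)=\sum_{i=1}^n |A_\pm(i)|$. The number of crossings of $\sigma$ is $C_+(\sigma)+C_-(\sigma)$ and the number of nestings is $A_+(\sigma)+A_-(\sigma)$. A descent of $\sigma$ is an index $i$ with $\sigma(i)>\sigma(i+1)$. The number of occurrences of the pattern $31\text{-}2$ in $\sigma$ is the number of pairs $i<j$ with $\sigma(i)>\sigma(j)>\sigma(i+1)$; the number of occurrences of $2\text{-}31$ is the number of pairs $i<j$ with $\sigma(j+1)<\sigma(i)<\sigma(j)$. For $n=0$ the only permutation is the empty one. *)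

(* Defs.v *)
From mathcomp Require Import all_boot all_fingroup.

Set Implicit Arguments.
Unset Strict Implicit.
Unset Printing Implicit Defensive.

(* Permutations of [n] = {1, ..., n} are elements of 'S_n, which act on
   {0, ..., n-1}; all the statistics below only compare positions and values,
   so they are unaffected by this shift. *)

Section Statistics.

Variables (n : nat) (s : 'S_n).

Definition weak_exceedances : nat := #|[set j : 'I_n | j <= s j]|.

Definition Cplus (i : 'I_n) : {set 'I_n} :=
  [set j : 'I_n | (j < i) && (i <= s j < s i)].

Definition Cminus (i : 'I_n) : {set 'I_n} :=
  [set j : 'I_n | [&& j > i, i > s j & s j > s i]].

Definition Aplus (i : 'I_n) : {set 'I_n} :=
  [set j : 'I_n | (j < i) && (i <= s i < s j)].

Definition Aminus (i : 'I_n) : {set 'I_n} :=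
  [set j : 'I_n | [&& j > i, i > s i & s i > s j]].

Definition crossings : nat :=
  \sum_(i < n) #|Cplus i| + \sum_(i < n) #|Cminus i|.

Definition nestings : nat :=
  \sum_(i < n) #|Aplus i| + \sum_(i < n) #|Aminus i|.

(* In the next three definitions the position i' (resp. j') following i
   (resp. j) is quantified existentially, so that the last position, which has
   no successor in 'I_n, is never counted. *)
Definition descents : nat :=
  #|[set i : 'I_n | [exists i' : 'I_n, (i' == i.+1 :> nat) && (s i > s i')]]|.

Definition occ_31_2 : nat :=
  #|[set p : 'I_n * 'I_n | let: (i, j) := p in
      (i < j) && [exists i' : 'I_n,
        [&& i' == i.+1 :> nat, s i > s j & s j > s i']]]|.

Definition occ_2_31 : nat :=
  #|[set p : 'I_n * 'I_n | let: (i, j) := p in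
      (i < j) && [exists j' : 'I_n,
        [&& j' == j.+1 :> nat, s j' < s i & s i < s j]]]|.

End Statistics.

Definition B (n k l m : nat) : nat :=
  #|[set s : 'S_n | [&& weak_exceedances s == k,
                        crossings s == l & nestings s == m]]|.

(* Having n - k descents is written additively because subtraction on nat is
   truncated: when k > n no permutation is counted. *)
Definition D (n k l m : nat) : nat :=
  #|[set s : 'S_n | [&& descents s + k == n,
                        occ_31_2 s == l & occ_2_31 s == m]]|.

(* Main.v *)
(* Both sides are read off weighted Motzkin paths. At level i a permutation gets
   two bits d, b and two numbers c, a, and the heights are h_i = c + a + d and
   h_(i+1) = c + a + b, with h_0 = h_n = 0.
   - Foata-Zeilberger: d says that i is not a weak exceedance, b that
     s^-1(i) > i, and c, a count the crossings and nestings at i. The values of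
     s on weak exceedances and on the other positions are recovered from a,
     which is an inversion table of each of the two restrictions.
   - Francon-Viennot: for a value v, d and b say that v is the top or the bottom
     of a descent, and c, a count the occurrences of 31-2 and 2-31 in which v
     plays the role of 2. Inserting the values in increasing order, the place of
     v among the smaller values is determined by a and d.
   The paths of length n from height h to 0 number C(n, h) n!, hence there are
   n! closed ones, both injections are bijective, and they carry the two triples
   of statistics to the same triple (sum of 1 - d, sum of c, sum of a). *)
Require Import Defs.
From mathcomp Require Import all_boot all_fingroup.
From mathcomp Require Import zify.

Set Implicit Arguments.
Unset Strict Implicit.
Unset Printing Implicit Defensive.

(** * Weighted Motzkin paths and their number *)

(* (d, b, c, a) *)
Notation step := (bool * bool * nat * nat)%type.

Definition sdesc (x : step) : nat := x.1.1.1.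
Definition sbot (x : step) : nat := x.1.1.2.
Definition scross (x : step) : nat := x.1.2.
Definition snest (x : step) : nat := x.2.

(** The height forces [c + a = h - d], so [a] takes [h - d + 1] values and determines [c]. *)
Definition prepend_step (rest : nat -> seq (seq step)) (h : nat) (d b : bool) :=
  if d <= h then
    [seq (d, b, h - d - a, a) :: w | a <- iota 0 (h - d).+1,
                                     w <- rest (h - d + b)]
  else [::].

(* Only the steps are recorded: the heights are determined by the first one. *)
Fixpoint paths (n h : nat) : seq (seq step) :=
  if n is n'.+1 then
    flatten [seq prepend_step (paths n') h x.1 x.2 |
      x <- [:: (false, false); (false, true); (true, false); (true, true)]]
  else if h is 0 then [:: [::]] else [::].

Lemma size_prepend_step rest h d b :
  size (prepend_step rest h d b) =
    if d <= h then (h - d).+1 * size (rest (h - d + b)) else 0.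
Proof. by rewrite /prepend_step; case: ifP; rewrite ?size_allpairs ?size_iota. Qed.

Lemma pathsS n h : paths n.+1 h =
  flatten [seq prepend_step (paths n) h x.1 x.2 |
    x <- [:: (false, false); (false, true); (true, false); (true, true)]].
Proof. by []. Qed.

(** Splitting off the first step gives [p(n+1,h) = (h+1)(p(n,h) + p(n,h+1)) + h(p(n,h-1) + p(n,h))],
    a recurrence that the closed form satisfies. *)
Lemma size_paths n h : size (paths n h) = 'C(n, h) * n`!.
Proof.
elim: n h => [|n IHn] h; first by case: h.
rewrite pathsS size_flatten /shape -map_comp.
rewrite (eq_map (fun x => size_prepend_step _ _ _ _)) factS.
rewrite /= !IHn {IHn} subn0 !addn0 !addn1.
case: h => [|h]; first by rewrite !bin0 bin1 /=; nia.
rewrite ltn0Sn subn1 succnK binS.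
have [le_hn|lt_nh] := leqP h n; last first.
  by rewrite !bin_small //; lia.
have e1 := mul_bin_left n h; have e2 := mul_bin_left n h.+1.
have [lt_hn|le_nh] := ltnP h n.
  (* Absorption identities freed of truncated subtraction, which [h < n] permits. *)
  have {}e1 : h.+1 * 'C(n, h.+1) + h * 'C(n, h) = n * 'C(n, h) by nia.
  have {}e2 : h.+2 * 'C(n, h.+2) + h.+1 * 'C(n, h.+1) = n * 'C(n, h.+1) by nia.
  nia.
have -> : h = n by lia.
by rewrite binn !bin_small //; nia.
Qed.

Lemma mem_paths (w : seq step) (h : nat -> nat) :
    (forall i, i < size w -> let x := nth (false, false, 0, 0) w i in
      h i = scross x + snest x + sdesc x /\
      h i.+1 = scross x + snest x + sbot x) ->
  h (size w) = 0 -> w \in paths (size w) (h 0).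
Proof.
elim: w h => [|x w IHw] h step_w; first by move=> /= ->.
rewrite -[size (x :: w)]/(size w).+1 pathsS => hn.
apply/flatten_mapP; exists (x.1.1.1, x.1.1.2).
  by case: (x.1.1) => [[] []].
have {IHw} /(_ hn) Hw := IHw (fun i => h i.+1) (fun i => step_w i.+1).
have [] := step_w 0 isT; case: x {step_w} => [[[d b] c] a].
rewrite /scross /snest /sdesc /sbot /= => h0 h1; rewrite h1 in Hw.
have -> : h 0 = c + a + d by [].
rewrite /prepend_step leq_addl addnK; apply/allpairsP; exists (a, w).
by rewrite mem_iota addnK Hw; split=> //=; lia.
Qed.

(** Pigeonhole: [n!] distinct words inside a list of length [n!] exhaust it, and this also shows
    that the list has no repetition. *)
Lemma perm_map_paths n (f : 'S_n -> seq step) :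
  injective f -> (forall s, f s \in paths n 0) ->
  perm_eq (map f (enum 'S_n)) (paths n 0).
Proof.
move=> f_inj f_path.
have uniq_f : uniq (map f (enum 'S_n)) by rewrite map_inj_uniq ?enum_uniq.
have sub_f : {subset map f (enum 'S_n) <= paths n 0} by move=> _ /mapP[s _ ->].
have le_size : size (paths n 0) <= size (map f (enum 'S_n)).
  by rewrite size_paths bin0 mul1n size_map -cardE card_Sn.
have [_ eq_f] := uniq_min_size uniq_f sub_f le_size.
by apply: uniq_perm => //; apply: leq_size_uniq le_size.
Qed.

Definition history n (f : 'I_n -> step) : seq step := map f (enum 'I_n).

Lemma history_inj n (f g : 'I_n -> step) : history f = history g -> f =1 g.
Proof. by move=> /eq_in_map eq_fg i; apply: eq_fg; rewrite mem_enum. Qed.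

Lemma history_paths n (f : 'I_n -> step) (h : nat -> nat) :
    h 0 = 0 -> h n = 0 ->
    (forall i : 'I_n, h i = scross (f i) + snest (f i) + sdesc (f i)) ->
    (forall i : 'I_n, h i.+1 = scross (f i) + snest (f i) + sbot (f i)) ->
  history f \in paths n 0.
Proof.
move=> h0 hn fd fb; have size_f : size (history f) = n.
  by rewrite size_map size_enum_ord.
rewrite -[n in paths n _]size_f -h0; apply: mem_paths; rewrite size_f //.
move=> i lt_in x; rewrite {}/x (nth_map (Ordinal lt_in)) ?size_enum_ord //.
have -> : nth (Ordinal lt_in) (enum 'I_n) i = Ordinal lt_in.
  by apply: val_inj; rewrite /= nth_enum_ord.
by rewrite -fd -fb.
Qed.

Lemma sum_history n (f : 'I_n -> step) (g : step -> nat) :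
  \sum_(x <- history f) g x = \sum_i g (f i).
Proof. by rewrite big_map big_enum. Qed.

(** * Counting below a bound, and inversion tables *)

Lemma card_ltn_ord n m : m <= n -> #|[set i : 'I_n | i < m]| = m.
Proof.
move=> le_mn; rewrite -sum1_card (eq_bigl (fun i : 'I_n => i < m)).
  by rewrite (big_ord_narrow le_mn) sum1_card card_ord.
by move=> i; rewrite inE.
Qed.

Lemma card_perm_ltn n (s : 'S_n) m : m <= n -> #|[set i | s i < m]| = m.
Proof.
move=> le_mn; rewrite -[RHS](card_ltn_ord le_mn).
rewrite -(card_preimset [set i : 'I_n | i < m] (@perm_inj _ s)).
by apply: eq_card => i; rewrite !inE.
Qed.

(** Descending induction along the strict total order [R]. If [R (s i) (t i)], each value counted
    for [t] at [i] is also counted for [s], because the images are equal and [s], [t] agree after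
    [i]; the value [t i] is counted for [s] only, so the two numbers differ. *)
Lemma inversion_table_inj (T : finType) (R : rel T) (E : {set T}) (s t : T -> T) :
    irreflexive R -> transitive R -> (forall x y, [|| R x y, x == y | R y x]) ->
    injective s -> injective t -> s @: E = t @: E ->
    {in E, forall i, #|[set j in E | R j i && R (s i) (s j)]| =
                     #|[set j in E | R j i && R (t i) (t j)]|} ->
  {in E, s =1 t}.
Proof.
move=> Rirr Rtr Rtot s_inj t_inj eq_im eq_inv.
have Rasym x y : R x y -> R y x -> False.
  by move=> Rxy /(Rtr _ _ _ Rxy); rewrite Rirr.
have one_side (f g : T -> T) i : injective f -> injective g ->
    f @: E = g @: E -> i \in E -> {in E, forall k, R i k -> f k = g k} ->
    R (f i) (g i) ->
    #|[set j in E | R j i && R (g i) (g j)]| <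
    #|[set j in E | R j i && R (f i) (f j)]|.
  move=> f_inj g_inj eq_fg iE IH lt_fg.
  rewrite -[ltnLHS](card_imset _ g_inj) -[ltnRHS](card_imset _ f_inj); apply: proper_card.
  (* Covers the values counted for [g] and, with [j = i], the extra value [g i]. *)
  have witness j : j \in E -> (j == i) || R j i -> R (f i) (g j) ->
      g j \in f @: [set j in E | R j i && R (f i) (f j)].
    move=> jE le_ji lt_ij; have: g j \in f @: E by rewrite eq_fg imset_f.
    case/imsetP=> k kE def_k; rewrite def_k imset_f // inE kE -def_k lt_ij andbT.
    case/or3P: (Rtot k i) => [//|/eqP eq_ki|lt_ik].
      by move: lt_ij; rewrite def_k eq_ki Rirr.
    have: g j = g k by rewrite def_k IH.
    move/g_inj=> eq_jk; case/predU1P: le_ji => [eq_ji|lt_ji].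
      by move: lt_ik; rewrite -eq_jk eq_ji Rirr.
    by case: (Rasym _ _ lt_ik); rewrite -eq_jk.
  apply/properP; split.
    apply/subsetP=> _ /imsetP[j /[!inE] /and3P[jE lt_ji lt_gij] ->].
    by apply: witness; rewrite ?lt_ji ?orbT //; apply: Rtr lt_fg lt_gij.
  exists (g i); first by apply: witness; rewrite ?eqxx.
  apply/imsetP=> -[j]; rewrite inE => /and3P[_ lt_ji _] /g_inj eq_ij.
  by rewrite eq_ij Rirr in lt_ji.
(* Induction on the number of elements after [i]. *)
suff main m : forall i, #|[set k | R i k]| < m -> i \in E -> s i = t i.
  by move=> i; apply: main (ltnSn _).
elim: m => // m IHm i le_im iE.
have IH : {in E, forall k, R i k -> s k = t k}.
  move=> k kE lt_ik; apply: IHm kE; rewrite ltnS in le_im.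
  apply: leq_trans _ le_im; apply: proper_card.
  apply/properP; split.
    by apply/subsetP=> l /[!inE]; apply: Rtr.
  by exists k; rewrite !inE ?Rirr.
case/or3P: (Rtot (s i) (t i)) => [lt_st|/eqP//|lt_ts].
  have := one_side s t i s_inj t_inj eq_im iE IH lt_st.
  by rewrite eq_inv // ltnn.
have := one_side t s i t_inj s_inj (esym eq_im) iE
  (fun k kE lt => esym (IH k kE lt)) lt_ts.
by rewrite eq_inv // ltnn.
Qed.

(** * The Foata-Zeilberger history *)

Section CrossingHistory.

Variable n : nat.
Implicit Type s : 'S_n.

Definition exc_step s (i : 'I_n) : step :=
  (s i < i, i < (s^-1)%g i,
   #|Cplus s i| + #|Cminus s i|, #|Aplus s i| + #|Aminus s i|).

(** Height of the path: the arcs from [j] down to [s j] that pass the gap just before [i]. The index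
    is a [nat] so that [i = n] is allowed. *)
Definition open_arcs s (i : nat) : nat := #|[set j : 'I_n | (i <= j) && (s j < i)]|.

Lemma exc_plus0 s (i : 'I_n) : s i < i -> Cplus s i = set0 /\ Aplus s i = set0.
Proof. by move=> lt_si; split; apply/setP=> j; rewrite !inE; lia. Qed.

Lemma exc_minus0 s (i : 'I_n) : i <= s i -> Cminus s i = set0 /\ Aminus s i = set0.
Proof. by move=> lt_si; split; apply/setP=> j; rewrite !inE; lia. Qed.

(** Exactly [i] positions and [i] values lie below [i]; discarding the arcs with both ends below
    leaves equally many in each direction. *)
Lemma open_arcs_upper s i : i <= n ->
  open_arcs s i = #|[set j : 'I_n | (j < i) && (i <= s j)]|.
Proof.
move=> le_in; have e1 := card_perm_ltn s le_in; have e2 := card_ltn_ord le_in.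
rewrite -(cardsID [set j : 'I_n | j < i]) in e1.
rewrite -(cardsID [set j : 'I_n | s j < i]) setIC in e2.
apply: (@addnI #|[set j | s j < i] :&: [set j : 'I_n | j < i]|).
transitivity i; [rewrite -[RHS]e1 | rewrite -[LHS]e2]; congr (_ + _);
  by apply: eq_card => j; rewrite !inE; lia.
Qed.

(** An arc around [i] in the direction of the arc at [i] crosses it or is nested with it, according
    to the side of [s i] on which it ends. When [i <= s i] these arcs go up, and [open_arcs_upper]
    converts their number. *)
Lemma inner_arcs s (i : 'I_n) :
  #|Cplus s i| + #|Cminus s i| + (#|Aplus s i| + #|Aminus s i|) =
  #|[set j : 'I_n | (i < j) && (s j < i)]|.
Proof.
have s_neq (j : 'I_n) : i != j -> s i != s j :> nat.
  by apply: contra => /eqP/val_inj/perm_inj->.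
case: (ltnP (s i) i) => [lt_si|le_is].
  have [-> ->] := exc_plus0 lt_si; rewrite cards0 !add0n -cardsUI.
  rewrite [X in _ + X](_ : _ = 0); last first.
    by apply/eqP; rewrite cards_eq0; apply/eqP/setP=> j; rewrite !inE; lia.
  rewrite addn0; apply: eq_card => j; rewrite !inE.
  have /= := s_neq j; rewrite -val_eqE /=; lia.
have [-> ->] := exc_minus0 le_is; rewrite cards0 !addn0.
(* Since [i <= s i], allowing [j = i] adds nothing and yields [open_arcs]. *)
have -> : [set j : 'I_n | (i < j) && (s j < i)] =
          [set j : 'I_n | (i <= j) && (s j < i)].
  apply/setP=> j; rewrite !inE; case: (eqVneq i j) => [<-|]; first by lia.
  by rewrite -val_eqE /=; lia.
rewrite -/(open_arcs s i) open_arcs_upper 1?ltnW // -cardsUI.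
rewrite [X in _ + X](_ : _ = 0); last first.
  by apply/eqP; rewrite cards_eq0; apply/eqP/setP=> j; rewrite !inE; lia.
rewrite addn0; apply: eq_card => j; rewrite !inE.
have /= := s_neq j; rewrite -val_eqE /=; lia.
Qed.

Lemma open_arcs_desc s (i : 'I_n) :
  open_arcs s i = #|[set j : 'I_n | (i < j) && (s j < i)]| + (s i < i).
Proof.
rewrite /open_arcs (cardsD1 i) inE leqnn addnC; congr (_ + _).
by apply: eq_card => j; rewrite !inE -val_eqE /=; lia.
Qed.

Lemma open_arcs_bot s (i : 'I_n) :
  open_arcs s i.+1 =
  #|[set j : 'I_n | (i < j) && (s j < i)]| + (i < (s^-1)%g i).
Proof.
rewrite /open_arcs (cardsD1 ((s^-1)%g i)) inE permKV ltnSn andbT addnC.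
congr (_ + _); apply: eq_card => j; rewrite !inE.
have -> : (j != (s^-1)%g i) = (s j != i :> nat).
  by rewrite val_eqE -(inj_eq (@perm_inj _ s)) permKV.
by lia.
Qed.

Lemma exc_history_paths s : history (exc_step s) \in paths n 0.
Proof.
apply: (@history_paths _ _ (open_arcs s)) => [||i|i].
- by apply: eq_card0 => j; rewrite !inE; lia.
- by apply: eq_card0 => j; rewrite !inE; have := ltn_ord j; lia.
- by rewrite /scross /snest /sdesc /= inner_arcs open_arcs_desc.
- by rewrite /scross /snest /sbot /= inner_arcs open_arcs_bot.
Qed.

(** The bit [d] fixes the positions with [s i < i] and [b] fixes their set of values. On each class
    the nestings form an inversion table, since [s j < s i < i < j] or [j < i <= s i < s j] already
    puts [j] in the class of [i]. *)
Lemma exc_history_inj : injective (fun s => history (exc_step s)).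
Proof.
move=> s t /history_inj eq_st.
have eq_desc i : (s i < i) = (t i < i) by have [] := eq_st i.
have eq_bot (i : 'I_n) : (i < (s^-1)%g i) = (i < (t^-1)%g i).
  by have [] := eq_st i.
have eq_nest i : #|Aplus s i| + #|Aminus s i| = #|Aplus t i| + #|Aminus t i|.
  by have [] := eq_st i.
have im_bot (u : 'S_n) (P : pred 'I_n) (Q : pred 'I_n) :
    (forall v, Q v = P ((u^-1)%g v)) -> u @: [set i | P i] = [set v | Q v].
  move=> eqQ; apply/setP=> v; rewrite inE eqQ; apply/imsetP/idP=> [[i]|Pv].
    by rewrite inE => Pi ->; rewrite permK.
  by exists ((u^-1)%g v); rewrite ?inE ?permKV.
have inv := @inversion_table_inj 'I_n _ _ s t _ _ _ (@perm_inj _ s) (@perm_inj _ t).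
apply/permP=> i; case: (ltnP (s i) i) => [lt_si|le_is].
  (* The order is reversed because [Aminus] looks at later positions with smaller values. *)
  apply: (inv (fun x y => y < x) [set i | s i < i]); last by rewrite inE.
  - by move=> x; rewrite ltnn.
  - by move=> x y z /= lt1 lt2; apply: ltn_trans lt2 lt1.
  - by move=> x y; rewrite -val_eqE /=; lia.
  - rewrite (im_bot s _ (fun v => v < (s^-1)%g v)) => [|v]; last by rewrite permKV.
    have -> : [set i | s i < i] = [set i | t i < i].
      by apply/setP=> j; rewrite !inE eq_desc.
    rewrite (im_bot t _ (fun v => v < (t^-1)%g v)) => [|v]; last by rewrite permKV.
    by apply/setP=> v; rewrite !inE eq_bot.
  move=> j /[!inE] lt_sj; have lt_tj := lt_sj; rewrite eq_desc in lt_tj.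
  have := eq_nest j; rewrite (exc_plus0 lt_sj).2 (exc_plus0 lt_tj).2 cards0 !add0n.
  move=> eqA; transitivity #|Aminus s j|; [|rewrite eqA];
    by apply: eq_card => k; have := eq_desc k; rewrite !inE; lia.
apply: (inv (fun x y => x < y) [set i : 'I_n | i <= s i]); last by rewrite inE.
- by move=> x; rewrite ltnn.
- by move=> x y z; apply: ltn_trans.
- by move=> x y; rewrite -val_eqE /=; lia.
- rewrite (im_bot s _ (fun v => (s^-1)%g v <= v)) => [|v]; last by rewrite permKV.
  have -> : [set i : 'I_n | i <= s i] = [set i : 'I_n | i <= t i].
    by apply/setP=> j; rewrite !inE leqNgt eq_desc -leqNgt.
  rewrite (im_bot t _ (fun v => (t^-1)%g v <= v)) => [|v]; last by rewrite permKV.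
  by apply/setP=> v; rewrite !inE leqNgt eq_bot -leqNgt.
move=> j /[!inE] lt_sj; have lt_tj : j <= t j by rewrite leqNgt -eq_desc -leqNgt.
have := eq_nest j; rewrite (exc_minus0 lt_sj).2 (exc_minus0 lt_tj).2 cards0 !addn0.
have eq_le (k : 'I_n) : (k <= s k) = (k <= t k) by rewrite leqNgt eq_desc -leqNgt.
move=> eqA; transitivity #|Aplus s j|; [|rewrite eqA];
  by apply: eq_card => k; have := eq_le k; rewrite !inE; lia.
Qed.

Lemma exc_history_desc s :
  \sum_(x <- history (exc_step s)) sdesc x + weak_exceedances s = n.
Proof.
rewrite sum_history -[RHS](card_ord n) -(cardC (fun j => s j < j)).
congr (_ + _).
  rewrite -sum1_card [RHS]big_mkcond; apply: eq_bigr => j _.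
  by rewrite unfold_in /sdesc /=; case: (s j < j).
by apply: eq_card => j; rewrite !inE -leqNgt.
Qed.

Lemma exc_history_cross s :
  \sum_(x <- history (exc_step s)) scross x = crossings s.
Proof. by rewrite sum_history big_split. Qed.

Lemma exc_history_nest s :
  \sum_(x <- history (exc_step s)) snest x = nestings s.
Proof. by rewrite sum_history big_split. Qed.

End CrossingHistory.

Lemma card_subsingleton (T : finType) (P : pred T) :
  {in P &, forall x y, x = y} -> #|[set x | P x]| = [exists x, P x].
Proof.
move=> P1; case: existsP => [[x Px]|noP].
  by apply/eqP/cards1P; exists x; apply/setP=> y; rewrite !inE;
     apply/idP/eqP => [Py|-> //]; apply: P1.
by apply: eq_card0 => x; rewrite inE; apply/negP=> Px; case: noP; exists x.
Qed.

(** * The Francon-Viennot history *)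

Section DescentHistory.

Variable n : nat.
Implicit Types p q : 'S_n.

Definition precedes p (x y : 'I_n) := (p x).+1 == p y :> nat.

(** Descents straddling [v], indexed by their bottom [y]. With [v] as the 2, those to its left are
    the 31-2 and those to its right the 2-31. *)
Definition below_gap p (v y : 'I_n) :=
  (y < v) && [exists x : 'I_n, (v < x) && precedes p x y].

(* p gives positions: p v is the position of the value v, so p is s^-1. *)
Definition des_step p (v : 'I_n) : step :=
  ([exists y : 'I_n, (y < v) && precedes p v y],
   [exists x : 'I_n, (v < x) && precedes p x v],
   #|[set y | below_gap p v y && (p y < p v)]|,
   #|[set y | below_gap p v y && (p v < p y)]|).

(** Height of the path: the maximal runs of adjacent values below [v], each given by its first
    element. A run that opens the word has no predecessor and is not counted. *)
Definition block_start p (v : nat) (y : 'I_n) :=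
  (y < v) && [exists x : 'I_n, (v <= x) && precedes p x y].

Lemma precedes_injl p x x' y : precedes p x y -> precedes p x' y -> x = x'.
Proof.
move=> /eqP e /eqP e'; apply: (@perm_inj _ p); apply: val_inj; apply: succn_inj.
by rewrite e e'.
Qed.

Lemma precedes_injr p x y y' : precedes p x y -> precedes p x y' -> y = y'.
Proof.
by move=> /eqP e /eqP e'; apply: (@perm_inj _ p); apply: val_inj; rewrite /= -e -e'.
Qed.

Lemma pos_neq p (x y : 'I_n) : x != y :> nat -> p x != p y :> nat.
Proof. by apply: contra => /eqP/val_inj/perm_inj->. Qed.

Lemma card_gap p (v : 'I_n) :
  #|[set y | below_gap p v y]| = scross (des_step p v) + snest (des_step p v).
Proof.
rewrite -(cardsID [set y | p y < p v]); congr (_ + _).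
  by apply: eq_card => y; rewrite !inE.
apply: eq_card => y; rewrite !inE andbC; case gap_y: (below_gap p v y) => //=.
by have /andP[lt_yv _] := gap_y; have := @pos_neq p y v; lia.
Qed.

Lemma card_next p (v : 'I_n) :
  #|[set y : 'I_n | (y < v) && precedes p v y]| = sdesc (des_step p v).
Proof.
apply: card_subsingleton => x y /andP[_ xP] /andP[_ yP].
exact: precedes_injr xP yP.
Qed.

Lemma block_startE p (v y : 'I_n) :
  block_start p v y = below_gap p v y || (y < v) && precedes p v y.
Proof.
rewrite /block_start /below_gap -andb_orr; case: (y < v) => //=.
apply/existsP/orP => [[x /andP[]]|[/existsP[x /andP[lt_vx xy]]|vy]].
- rewrite leq_eqVlt => /predU1P[/val_inj<-|lt_vx] xy; [by right | left].
  by apply/existsP; exists x; rewrite lt_vx.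
- by exists x; rewrite ltnW.
- by exists v; rewrite leqnn.
Qed.

Lemma block_startSE p (v y : 'I_n) :
  block_start p v.+1 y =
  below_gap p v y || (y == v) && [exists x : 'I_n, (v < x) && precedes p x y].
Proof. by rewrite /block_start /below_gap -andb_orl ltnS leq_eqVlt orbC. Qed.

Lemma gap_next_disjoint p (v y : 'I_n) : below_gap p v y -> ~~ precedes p v y.
Proof.
case/andP=> _ /existsP[x /andP[lt_vx xy]]; apply/negP=> /(precedes_injl xy) eq_xv.
by rewrite eq_xv ltnn in lt_vx.
Qed.

Lemma card_block_start p (v : 'I_n) : #|[set y | block_start p v y]| =
  scross (des_step p v) + snest (des_step p v) + sdesc (des_step p v).
Proof.
rewrite -card_gap -card_next -(cardsID [set y | below_gap p v y]).
congr (_ + _); apply: eq_card => y; rewrite !inE block_startE.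
  by rewrite andbC; case: (below_gap p v y).
have := @gap_next_disjoint p v y; case: (below_gap p v y) => //= H.
by rewrite (negbTE (H isT)) andbF.
Qed.

Lemma card_block_startS p (v : 'I_n) : #|[set y | block_start p v.+1 y]| =
  scross (des_step p v) + snest (des_step p v) + sbot (des_step p v).
Proof.
rewrite -card_gap (cardsD1 v) addnC; congr (_ + _).
  apply: eq_card => y; rewrite !inE block_startSE.
  by case: eqVneq => [->|] /=; rewrite ?orbF // /below_gap ltnn.
by rewrite inE block_startSE eqxx /below_gap ltnn.
Qed.

Lemma des_history_paths p : history (des_step p) \in paths n 0.
Proof.
apply: (@history_paths _ _ (fun v => #|[set y | block_start p v y]|)) => [||v|v].
- by apply: eq_card0 => y; rewrite inE.
- apply: eq_card0 => y; rewrite inE; apply/negbTE; rewrite negb_and orbC.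
  apply/orP; left; apply/existsPn=> x; have := ltn_ord x; lia.
- exact: card_block_start.
- exact: card_block_startS.
Qed.

(** A block whose predecessor is [v] itself lies to the right of [v], which adds the bit [d] to
    [a]. *)
Lemma card_right_starts p (v : 'I_n) :
  #|[set y | block_start p v y && (p v < p y)]| =
  snest (des_step p v) + sdesc (des_step p v).
Proof.
rewrite -card_next -(cardsID [set y | below_gap p v y]).
congr (_ + _); apply: eq_card => y; rewrite !inE block_startE.
  by rewrite andbC; case: (below_gap p v y).
have := @gap_next_disjoint p v y; case: (below_gap p v y) => //= H.
  by rewrite (negbTE (H isT)) andbF.
by rewrite /precedes; lia.
Qed.

(* The block of consecutive values below v containing x is, when it lies to
   the right of v, preceded by a value at least v: its first element is a block
   start located after v but not after x. *)
Lemma right_of_new p (v x : 'I_n) : x < v ->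
  (p v < p x) = (#|[set y | block_start p v y && (p x < p y)]| <
                 #|[set y | block_start p v y && (p v < p y)]|).
Proof.
move=> lt_xv; apply/idP/idP => [lt_px|]; last first.
  apply: contraTT; rewrite -!leqNgt => le_px; apply: subset_leq_card.
  by apply/subsetP=> y; rewrite !inE => /andP[->] /=; lia.
apply: proper_card; apply/properP; split.
  by apply/subsetP=> y; rewrite !inE => /andP[->] /=; lia.
have P_v : (v <= v) && (p v < p x) by rewrite leqnn.
(* [z] is the last value at least [v] placed before [x]; by maximality its successor [y] is below
   [v]. *)
case: (@arg_maxnP _ v (fun z : 'I_n => (v <= z) && (p z < p x)) (fun z => p z) P_v).
move=> z /andP[le_vz lt_zx] max_z.
have lt_zn : (p z).+1 < n by apply: leq_ltn_trans lt_zx _.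
pose y := (p^-1)%g (Ordinal lt_zn).
have zy : precedes p z y by rewrite /precedes permKV.
have py : p y = (p z).+1 :> nat by rewrite permKV.
have lt_yv : y < v.
  rewrite ltnNge; apply/negP=> le_vy; have := max_z y; rewrite le_vy py /=.
  case: (eqVneq y x) => [eq_yx|]; first by rewrite eq_yx leqNgt lt_xv in le_vy.
  rewrite -val_eqE /= => /(@pos_neq p); rewrite py; move: lt_zx => /=; lia.
exists y; rewrite !inE /block_start lt_yv /=.
  have := max_z v P_v; rewrite py /=.
  have -> : [exists x0 : 'I_n, (v <= x0) && precedes p x0 y].
    by apply/existsP; exists z; rewrite le_vz.
  by rewrite /=; lia.
by rewrite py negb_and -leqNgt lt_zx orbT.
Qed.

(** A descent top is followed by the nearest smaller value on its right, so this adjacency is read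
    off the bit [d] of [x] and the relative positions of the values up to [x]. *)
Lemma precedes_desc p (x y : 'I_n) : y < x ->
  precedes p x y = [&& [exists z : 'I_n, (z < x) && precedes p x z],
    p x < p y & [forall z : 'I_n, (z < x) ==> ~~ (p x < p z < p y)]].
Proof.
move=> lt_yx; apply/idP/and3P => [xy|[/existsP[z /andP[lt_zx xz]] lt_xy /forallP no]].
  split; first by apply/existsP; exists y; rewrite lt_yx.
    by rewrite -(eqP xy).
  by apply/forallP=> z; apply/implyP=> _; rewrite -(eqP xy); lia.
have := no z; rewrite lt_zx -(eqP xz) /= ltnSn /= -leqNgt => le_yz.
rewrite /precedes; lia.
Qed.

(** The bit [b] of [y] says that its predecessor is larger; adjacencies among values below [v] then
    tell whether it reaches [v]. *)
Lemma block_start_desc p (v : nat) (y : 'I_n) : y < v ->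
  block_start p v y = [exists x : 'I_n, (y < x) && precedes p x y] &&
    ~~ [exists x : 'I_n, (y < x < v) && precedes p x y].
Proof.
move=> lt_yv; rewrite /block_start lt_yv /=.
apply/existsP/andP => [[x /andP[le_vx xy]]|[/existsP[x /andP[lt_yx xy]]]].
  split; first by apply/existsP; exists x; rewrite xy (leq_trans lt_yv).
  apply/existsP=> -[z /andP[/andP[_ lt_zv] /(precedes_injl xy) eq_xz]].
  by rewrite -eq_xz ltnNge le_vx in lt_zv.
move/existsPn/(_ x); rewrite xy lt_yx /= !andbT -leqNgt => le_vx.
by exists x; rewrite le_vx.
Qed.

Lemma same_order_inj p q : (forall x y, (p x < p y) = (q x < q y)) -> p = q.
Proof.
move=> eq_pq; apply/permP=> x; apply: val_inj => /=.
rewrite -(card_perm_ltn p (ltnW (ltn_ord (p x)))).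
rewrite -(card_perm_ltn q (ltnW (ltn_ord (q x)))).
by apply: eq_card => y; rewrite !inE eq_pq.
Qed.

Lemma des_history_inj : injective (fun p => history (des_step p)).
Proof.
move=> p q /history_inj eq_pq; apply: same_order_inj.
have eq_desc (v : 'I_n) : [exists y : 'I_n, (y < v) && precedes p v y] =
    [exists y : 'I_n, (y < v) && precedes q v y] by have [] := eq_pq v.
have eq_bot (v : 'I_n) : [exists x : 'I_n, (v < x) && precedes p x v] =
    [exists x : 'I_n, (v < x) && precedes q x v] by have [] := eq_pq v.
(* Insert the values in increasing order: the histories determine the relative positions of the
   values below [v], by induction on [v]. *)
suff order_upto v : forall x y : 'I_n, x < v -> y < v -> (p x < p y) = (q x < q y).
  by move=> x y; apply: (order_upto n).
elim: v => // v IHv.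
have eq_prec (x y : 'I_n) : y < x -> x < v -> precedes p x y = precedes q x y.
  move=> lt_yx lt_xv; have lt_yv := ltn_trans lt_yx lt_xv.
  rewrite !precedes_desc // eq_desc IHv //; congr [&& _, _ & _].
  apply: eq_forallb => z; case: ltnP => //= lt_zx.
  by rewrite !IHv // (ltn_trans lt_zx).
have eq_start y : block_start p v y = block_start q v y.
  case: (ltnP y v) => [lt_yv|le_vy]; last by rewrite /block_start ltnNge le_vy.
  rewrite !block_start_desc // eq_bot; congr (_ && ~~ _).
  apply: eq_existsb => x; case: ltnP => //= lt_yx; case: ltnP => //= lt_xv.
  exact: eq_prec.
(* The new value is compared with [x] through the numbers of block starts to their right: [a + d]
   for [w], and for [x] a number given by the known order. *)
have eq_new (w x : 'I_n) : w = v :> nat -> x < v -> (p w < p x) = (q w < q x).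
  move=> def_w lt_xv; rewrite -def_w in IHv eq_start lt_xv.
  rewrite !right_of_new // !card_right_starts eq_pq; congr (_ < _).
  apply: eq_card => y; rewrite !inE eq_start.
  by case start_y: (block_start q w y) => //=; apply: IHv; case/andP: start_y.
move=> x y; rewrite !ltnS leq_eqVlt => /predU1P[def_x|lt_xv].
  rewrite leq_eqVlt => /predU1P[def_y|lt_yv]; last exact: eq_new.
  have -> : x = y by apply: val_inj; rewrite /= def_x.
  by rewrite !ltnn.
rewrite leq_eqVlt => /predU1P[def_y|lt_yv]; last exact: IHv.
have neq_xy : x != y :> nat by rewrite def_y neq_ltn lt_xv.
have := eq_new y x def_y lt_xv; have := @pos_neq p _ _ neq_xy.
have := @pos_neq q _ _ neq_xy; rewrite /=; lia.
Qed.

End DescentHistory.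

(** * Descents and patterns read off the history *)

Lemma exists_reindex_perm n (s : 'S_n) (P : pred 'I_n) :
  [exists i, P (s i)] = [exists v, P v].
Proof.
apply/existsP/existsP => [[i Pi]|[v Pv]]; first by exists (s i).
by exists ((s^-1)%g v); rewrite permKV.
Qed.

Lemma card_reindex_perm n (s : 'S_n) (P : pred 'I_n) :
  #|[set i | P (s i)]| = #|[set v | P v]|.
Proof.
rewrite -(card_preimset [set v | P v] (@perm_inj _ s)).
by apply: eq_card => i; rewrite !inE.
Qed.

(** Both sides count adjacent pairs: the patterns index them by the first position, [below_gap] by
    the second. *)
Lemma card_successor n (Q : 'I_n -> 'I_n -> bool) :
  #|[set i : 'I_n | [exists j : 'I_n, (j == i.+1 :> nat) && Q i j]]| =
  #|[set j : 'I_n | [exists i : 'I_n, (j == i.+1 :> nat) && Q i j]]|.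
Proof.
pose A := [set u : 'I_n * 'I_n | (u.2 == u.1.+1 :> nat) && Q u.1 u.2].
transitivity #|A|.
  rewrite -(@card_in_imset _ _ fst A).
    apply: eq_card => i; rewrite inE; apply/existsP/imsetP.
      by move=> [j ij]; exists (i, j); rewrite ?inE.
    by move=> [[i' j]]; rewrite inE /= => ij ->; exists j.
  move=> [i j] [i' j']; rewrite !inE /= => /andP[/eqP e _] /andP[/eqP e' _] eq_i.
  by rewrite eq_i in e *; congr pair; apply: val_inj; rewrite /= e e'.
rewrite -(@card_in_imset _ _ snd A).
  apply: eq_card => j; rewrite inE; apply/imsetP/existsP.
    by move=> [[i j']]; rewrite inE /= => ij ->; exists i.
  by move=> [i ij]; exists (i, j); rewrite ?inE.
move=> [i j] [i' j']; rewrite !inE /= => /andP[/eqP e _] /andP[/eqP e' _] eq_j.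
by rewrite eq_j e' in e *; congr pair; apply: val_inj; case: e.
Qed.

Section DescentStatistics.

Variables (n : nat) (s : 'S_n).

Lemma des_history_desc :
  \sum_(x <- history (des_step s^-1)) sdesc x = descents s.
Proof.
(* Setting [v = s i] turns the position of [v] back into [i]. *)
rewrite sum_history (reindex_inj (@perm_inj _ s)) /descents.
rewrite -sum1_card [RHS]big_mkcond.
apply: eq_bigr => i _; rewrite inE /sdesc /= -(exists_reindex_perm s).
rewrite (_ : [exists j, _] =
             [exists i' : 'I_n, (i' == i.+1 :> nat) && (s i > s i')]).
  by case: [exists i', _].
by apply: eq_existsb => j; rewrite /precedes !permK andbC eq_sym.
Qed.

Lemma des_history_nest :
  \sum_(x <- history (des_step s^-1)) snest x = occ_2_31 s.
Proof.
rewrite sum_history (reindex_inj (@perm_inj _ s)) /=.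
transitivity (\sum_(i < n) #|[set j : 'I_n | [exists j' : 'I_n, (j' == j.+1 :> nat) &&
    ((i < j) && (s j' < s i < s j))]]|); last first.
  under eq_bigr => i _ do rewrite -sum1dep_card.
  rewrite pair_big_dep /= sum1dep_card; apply: eq_card => -[i j]; rewrite !inE /=.
  apply/existsP/andP => [[j' /and3P[e lt_ij H]]|[lt_ij /existsP[j' /andP[e H]]]].
    by split=> //; apply/existsP; exists j'; rewrite e.
  by exists j'; rewrite e lt_ij.
apply: eq_bigr => i _; rewrite card_successor /snest /= -(card_reindex_perm s).
apply: eq_card => j; rewrite !inE /below_gap !permK -(exists_reindex_perm s).
apply/andP/existsP => [[/andP[lt_ji /existsP[k /andP[lt_ik]]]]|].
  rewrite /precedes !permK => /eqP e lt_ij; exists k.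
  rewrite -e eqxx lt_ji lt_ik andbT /=.
  (* From [i < j = k + 1] only [i <= k] follows; comparing values excludes equality. *)
  have : i != k by apply: contraTneq lt_ik => ->; rewrite ltnn.
  by rewrite -val_eqE /=; lia.
move=> [k /and3P[/eqP e lt_ik /andP[lt_ji lt_ij]]]; split; last by rewrite e; lia.
by rewrite lt_ji; apply/existsP; exists k; rewrite lt_ij /precedes !permK e eqxx.
Qed.

Lemma des_history_cross :
  \sum_(x <- history (des_step s^-1)) scross x = occ_31_2 s.
Proof.
rewrite sum_history (reindex_inj (@perm_inj _ s)) /=.
transitivity (\sum_(j < n) #|[set i : 'I_n | [exists i' : 'I_n, (i' == i.+1 :> nat) &&
    ((i < j) && (s i' < s j < s i))]]|); last first.
  under eq_bigr => i _ do rewrite -sum1dep_card.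
  rewrite (exchange_big_dep predT) //= pair_big_dep /= sum1dep_card.
  apply: eq_card => -[i j]; rewrite !inE /=.
  apply/existsP/andP => [[j' /and4P[e lt_ij H H']]|[lt_ij /existsP[j' /and3P[e H H']]]].
    by split=> //; apply/existsP; exists j'; rewrite e H H'.
  by exists j'; rewrite e lt_ij H H'.
apply: eq_bigr => i _; rewrite card_successor /scross /= -(card_reindex_perm s).
apply: eq_card => j; rewrite !inE /below_gap !permK -(exists_reindex_perm s).
apply/andP/existsP => [[/andP[lt_ji /existsP[k /andP[lt_ik]]]]|].
  rewrite /precedes !permK => /eqP e lt_ij; exists k.
  by rewrite -e eqxx lt_ji lt_ik andbT /=; lia.
move=> [k /and3P[/eqP e lt_ik /andP[lt_ji lt_ij]]]; split.
  by rewrite lt_ji; apply/existsP; exists k; rewrite lt_ij /precedes !permK e eqxx.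
(* Here [k < i] and [j = k + 1] leave [i = j] to be excluded, again by the values. *)
have : i != j by apply: contraTneq lt_ji => ->; rewrite ltnn.
by rewrite -val_eqE /=; lia.
Qed.

End DescentStatistics.

Theorem theorem1 (n k l m : nat) : B n k l m = D n k l m.
Proof.
(* One test serves both sides: [k] weak exceedances and [n - k] descents each mean that the bits [d]
   sum to [n - k]. *)
pose stats (w : seq step) := [&& \sum_(x <- w) sdesc x + k == n,
  \sum_(x <- w) scross x == l & \sum_(x <- w) snest x == m].
have card_enum (P : pred 'S_n) (f : 'S_n -> seq step) :
    P =1 preim f stats -> #|[set s | P s]| = count stats (map f (enum 'S_n)).
  move=> eqP; rewrite cardsE count_map -(eq_count eqP) cardE -size_filter.
  by rewrite enumT.
have inj_des : injective (fun s : 'S_n => history (des_step s^-1)).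
  by move=> s t /des_history_inj/invg_inj.
rewrite /B /D.
rewrite (card_enum _ (fun s => history (exc_step s))) => [|s]; last first.
  rewrite /stats /= exc_history_cross exc_history_nest; congr (_ && _).
  by have e := exc_history_desc s; lia.
rewrite (card_enum _ (fun s => history (des_step s^-1))) => [|s]; last first.
  by rewrite /stats /= des_history_desc des_history_cross des_history_nest.
(* Both lists of histories rearrange the list of closed paths, so [stats] holds equally often in
   them. *)
apply/seq.permP; apply: perm_trans (perm_map_paths (@exc_history_inj n) _) _.
  exact: exc_history_paths.
rewrite perm_sym; apply: perm_map_paths => // s; exact: des_history_paths.
Qed.
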